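(* Let $N\ge2$, $h=1/N$, $\eta\in[0,\frac1{480})$, and for $j\in\{1,\dots,N-1\}$ let $\lambda_j=j^2\pi^2$ be the $j$-th Dirichlet eigenvalue of $-\frac{d^2}{dx^2}$ on $[0,1]$, and let $\hat\lambda^h_j$ be the $j$-th approximate eigenvalue of the $C^2$-cubic softIGA discretization with $N$ uniform elements on $[0,1]$ and softness parameter $\eta$ (see context). Then $$\frac{|\hat\lambda^h_j-\lambda_j|}{\lambda_j}<\Big(\frac{131}{332640}+\eta\Big)(j\pi h)^6\qquad\text{for all } j\in\{1,\dots,N-1\}.$$ Moreover, if $\eta=\frac1{30240}$, then $$\frac{|\hat\lambda^h_j-\lambda_j|}{\lambda_j}<\frac{1}{27720}(j\pi h)^8\qquad\text{for all } j\in\{1,\dots,N-1\}.$$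
   Context: The $C^2$-cubic softIGA discretization of $-u''=\lambda u$ on $[0,1]$, $u(0)=u(1)=0$, is the generalized matrix eigenvalue problem $(\tilde K_3-\eta S_3)\hat U=\hat\lambda^h\tilde M_3\hat U$, where $\tilde K_3,\tilde M_3,S_3$ are the matrices, in the (boundary-modified) B-spline basis of the space of $C^2$ piecewise cubics $w$ on the uniform mesh with $w=w''=0$ at $0$ and $1$, of the bilinear forms $\int_0^1v'w'\,dx$, $\int_0^1 vw\,dx$, and $h^{5}\sum_{\text{interior nodes}}[\![v''']\!][\![w''']\!]$. Explicitly, they are $(N-1)\times(N-1)$ matrices of the form $$A_{kl}=\sum_{m\in\mathbb Z}\big(a_{|k-l+2Nm|}-a_{|k+l+2Nm|}\big),\qquad 1\le k,l\le N-1,$$ with stencils (entries not listed are $0$): $\tilde K_3$: $(a_0,\dots,a_3)=\frac1h(\frac23,-\frac18,-\frac15,-\frac1{120})$; $\tilde M_3$: $(a_0,\dots,a_3)=h(\frac{151}{315},\frac{397}{1680},\frac1{42},\frac1{5040})$; $S_3$: $(a_0,\dots,a_4)=\frac1h(70,-56,28,-8,1)$. With $t_j=j\pi h$, the approximate eigenvalue $\hat\lambda^h_j$ paired with $\lambda_j$ is the eigenvalue of this problem whose eigenvector is $\big(\sin(kt_j)\big)_{k=1}^{N-1}$; it equals $$\hat\lambda^h_j=\frac{168\sin^2(t_j/2)}{h^2}\cdot\frac{33-1200\eta+2(13+900\eta)\cos t_j+(1-720\eta)\cos2t_j+120\eta\cos3t_j}{1208+1191\cos t_j+120\cos2t_j+\cos3t_j}.$$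 (For $\eta\le\frac{69}{79360}$ this coincides with listing eigenvalues in ascending order.) *)

(* Defs.v *)
From mathcomp Require Import all_boot all_order all_algebra.
From mathcomp Require Import all_classical all_reals all_analysis.

Set Implicit Arguments.
Unset Strict Implicit.
Unset Printing Implicit Defensive.

Import Order.TTheory GRing.Theory Num.Theory.

Local Open Scope classical_set_scope.
Local Open Scope ring_scope.

(* Numerals in ring_scope are unary natural numbers, so that constants beyond
   a few thousand are written a * 1000 + b: 332 * 1000 + 640 is 332640. *)

Definition mesh_size (R : realType) (N : nat) : R := N%:R^-1.

(* The (N-1) x (N-1) matrix
     A_kl = sum_(m in Z) (a_|k - l + 2Nm| - a_|k + l + 2Nm|), 1 <= k, l <= N-1.
   Row i and column j of the matrix carry the indices k = i + 1, l = j + 1, and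
   a_n = 0 beyond the end of the list a, so that for N > 0 all but finitely
   many terms of the sum vanish. The two parts of the summand come from the
   2Nh-periodic extension of a spline that is odd about both end points, which
   is how the conditions w = w'' = 0 modify the B-splines at the boundary. *)
Definition stencil_mx (R : realType) (N : nat) (a : seq R) : 'M[R]_(N.-1) :=
  \matrix_(i, j)
    let k : int := Posz i.+1 in
    let l : int := Posz j.+1 in
    \sum_(m \in [set: int])
      (nth 0 a (absz (k - l + Posz (2 * N) * m))
       - nth 0 a (absz (k + l + Posz (2 * N) * m))).

(* Form int_0^1 v' w' dx *)
Definition stiffness_mx (R : realType) (N : nat) : 'M[R]_(N.-1) :=
  stencil_mx N [seq (mesh_size R N)^-1 * c
               | c <- [:: 2 / 3; - (1 / 8); - (1 / 5); - (1 / 120)]].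

(* Form int_0^1 v w dx *)
Definition mass_mx (R : realType) (N : nat) : 'M[R]_(N.-1) :=
  stencil_mx N [seq mesh_size R N * c
               | c <- [:: 151 / 315; 397 / 1680; 1 / 42; 1 / (5 * 1000 + 40)]].

(* Form h^5 * sum over the interior nodes of the products of the jumps of the
   third derivatives of v and w *)
Definition softness_mx (R : realType) (N : nat) : 'M[R]_(N.-1) :=
  stencil_mx N [seq (mesh_size R N)^-1 * c
               | c <- [:: 70; - 56; 28; - 8; 1]].

Definition softIGA_eigenpair (R : realType) (N : nat) (eta lam : R)
    (U : 'cV[R]_(N.-1)) : Prop :=
  U != 0 /\
  (stiffness_mx R N - eta *: softness_mx R N) *m U = lam *: (mass_mx R N *m U).

(* (sin (k t_j))_(1 <= k <= N-1) with t_j = j pi h *)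
Definition sine_mode (R : realType) (N j : nat) : 'cV[R]_(N.-1) :=
  \col_i sin (i.+1%:R * (j%:R * pi * mesh_size R N)).

(* mu is the approximate eigenvalue paired with the j-th exact one. The pairing
   is by eigenvector; it need not follow the ascending order of eigenvalues. *)
Definition approx_eigenvalue (R : realType) (N : nat) (eta : R) (j : nat)
    (mu : R) : Prop :=
  softIGA_eigenpair eta mu (sine_mode R N j).

(* j-th eigenvalue of - u'' = lambda u on [0, 1], u(0) = u(1) = 0 *)
Definition dirichlet_eigenvalue (R : realType) (j : nat) : R :=
  j%:R ^+ 2 * pi ^+ 2.

(* Main.v *)
Require Import Defs.
From mathcomp Require Import all_boot all_order all_algebra.
From mathcomp Require Import all_classical all_reals all_analysis.
From mathcomp Require Import zify ring lra.

(** Summing the stencils by residue classes mod 2N shows that the sine modes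
    diagonalise the three matrices. In terms of u = 2 - 2 cos t their symbols
    are k(u) / h, u^4 / h and h m(u), with cubic polynomials k and m, so the
    claim is that q(u) = (k(u) - eta u^4) / m(u) is close to t^2. For any
    smooth F, the second derivative of F(u(t)) is
    F''(u) u (4 - u) + F'(u) (2 - u), a function of u alone. Hence, after
    bounding t^2 from below by a Taylor polynomial in u, the second derivative
    of c t^(2p) +- (t^2 - q(u(t))) is bounded below by a rational function of
    u on [0, 4], whose positivity is read off Bernstein coefficients; as that
    function of t vanishes to second order at 0, it is positive. The bounds are
    affine in eta, so the first estimate is needed only at the two end points
    eta = 0 and eta = 1/480. *)

Import Order.TTheory GRing.Theory Num.Theory.
Import numFieldNormedType.Exports.

Local Open Scope ring_scope.

(** * Comparison with functions of the squared chord *)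

Section Comparison.
Context {R : realType}.
Implicit Types (t u s c e : R).

(** The mean value theorem, applied to [V] on [0, b] and then to [V1] on [0, c], writes [V b] as a
    product of positive factors. *)
Lemma convex_pos (V V1 V2 : R -> R) (b : R) :
  (forall t, is_derive t 1 V (V1 t)) -> (forall t, is_derive t 1 V1 (V2 t)) ->
  V 0 = 0 -> V1 0 = 0 -> (forall t, 0 < t < b -> 0 < V2 t) ->
  0 < b -> 0 < V b.
Proof.
move=> dV dV1 V0 V10 V2pos b0.
have cont (f f1 : R -> R) (df : forall t, is_derive t 1 f (f1 t)) x y :
    {within `[x, y], continuous f}%classic.
  apply: derivable_within_continuous => z _; exact: ex_derive.
have [c + ] := @MVT R V V1 0 b b0 (fun t _ => dV t) (cont _ _ dV _ _).
rewrite in_itv /= => /andP[c0 cb]; rewrite V0 !subr0 => ->.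
have [d + ] := @MVT R V1 V2 0 c c0 (fun t _ => dV1 t) (cont _ _ dV1 _ _).
rewrite in_itv /= => /andP[d0 dc]; rewrite V10 !subr0 => ->.
by rewrite !mulr_gt0 // V2pos // d0 (lt_trans dc).
Qed.

(** Squared length of the chord of the unit circle subtending the angle [t], that is 4
    sin^2(t/2). *)
Definition chord2 t : R := 2 - 2 * cos t.

Lemma chord2_ge0 t : 0 <= chord2 t.
Proof. by rewrite /chord2; have := cos_le1 t; lra. Qed.

Lemma chord2_le4 t : chord2 t <= 4.
Proof. by rewrite /chord2; have := cos_geN1 t; lra. Qed.

Lemma chord2_gt0 t : 0 < t < pi -> 0 < chord2 t.
Proof.
move=> /andP[t0 tpi].
suff : cos t < cos 0 by rewrite cos0 /chord2; lra.
by rewrite ltr_cos ?in_itv //= ?lexx ?pi_ge0 // ltW ?ltW.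
Qed.

Lemma chord2_le s t : 0 <= s <= t -> t <= pi -> chord2 s <= chord2 t.
Proof.
move=> /andP[s0 st] tpi.
suff : cos t <= cos s by rewrite /chord2; lra.
by rewrite leNgt ltr_cos ?in_itv //= ?s0 ?tpi ?(le_trans st) ?(le_trans s0) // -leNgt.
Qed.

Lemma is_derive_chord2 t : is_derive t 1 chord2 (2 * sin t).
Proof.
rewrite /chord2; apply: is_derive_eq.
rewrite /GRing.scale /=; ring.
Qed.

Lemma is_derive_pow (k : nat) (x : R) :
  is_derive x (1 : R) (fun y : R => y ^+ k) (k%:R * x ^+ k.-1).
Proof.
have -> : (fun y : R => y ^+ k) = id ^+ k by apply/funext => y; rewrite exprfctE.
by apply: is_derive_eq; rewrite /GRing.scale /= mulr1.
Qed.

Lemma is_derive_quintic (f : R -> R) (a0 a1 a2 a3 a4 a5 x : R) :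
  (forall u, f u = a0 + a1 * u + a2 * u ^+ 2 + a3 * u ^+ 3 + a4 * u ^+ 4
                   + a5 * u ^+ 5) ->
  is_derive x (1 : R) f (a1 + 2 * a2 * x + 3 * a3 * x ^+ 2 + 4 * a4 * x ^+ 3
                         + 5 * a5 * x ^+ 4).
Proof.
move=> /funext ->; have dX := is_derive_pow; apply: is_derive_eq.
by rewrite /GRing.scale /=; ring.
Qed.

(** Two derivatives turn t^(2n+2) into a multiple of t^(2n), which [W] bounds below; what remains is
    a condition on [u] alone. Taking [s] as 1 or -1 selects the side of the estimate, and [u1]
    allows a range shorter than [0, 4]. *)
Lemma chord2_comparison (F F1 F2 W : R -> R) c s u1 t (n : nat) :
  (forall u, 0 <= u <= 4 -> is_derive u 1 F (F1 u)) ->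
  (forall u, 0 <= u <= 4 -> is_derive u 1 F1 (F2 u)) ->
  (forall t, 0 < t < pi -> W (chord2 t) <= t ^+ (2 * n)) ->
  0 <= c -> F 0 = 0 ->
  (forall u, 0 < u <= u1 -> u <= 4 ->
     0 < c * ((2 * n).+2 * (2 * n).+1)%:R * W u + 2 * s
         + F2 u * (u * (4 - u)) + F1 u * (2 - u)) ->
  0 < t < pi -> chord2 t <= u1 ->
  0 < c * t ^+ (2 * n).+2 + s * t ^+ 2 + F (chord2 t).
Proof.
move=> dF dF1 Wt c0 F0 pos /andP[t0 tpi] tu1.
have u04 x : 0 <= chord2 x <= 4 by rewrite chord2_ge0 chord2_le4.
pose V x := c * x ^+ (2 * n).+2 + s * x ^+ 2 + F (chord2 x).
pose V1 x := c * (2 * n).+2%:R * x ^+ (2 * n).+1 + 2 * s * x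
   + F1 (chord2 x) * (2 * sin x).
pose V2 x := c * ((2 * n).+2 * (2 * n).+1)%:R * x ^+ (2 * n) + 2 * s
   + F2 (chord2 x) * (chord2 x * (4 - chord2 x)) + F1 (chord2 x) * (2 - chord2 x).
have dC := is_derive_chord2.
have dX := is_derive_pow.
pose G x := F (chord2 x); pose G1 x := F1 (chord2 x) * (2 * sin x).
have dG (x : R) : is_derive x (1 : R) (G : R -> R) (G1 x).
  by have dFx := dF _ (u04 x); apply: is_derive1_comp.
pose H x := F1 (chord2 x).
have dH (x : R) : is_derive x (1 : R) (H : R -> R) (F2 (chord2 x) * (2 * sin x)).
  by have dFx := dF1 _ (u04 x); apply: is_derive1_comp.
apply: (@convex_pos V V1 V2) => //.
- move=> x; have -> : V = fun y => c * y ^+ (2 * n).+2 + s * y ^+ 2 + G y by [].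
  by apply: is_derive_eq; rewrite /GRing.scale /= /V1 /G1; ring.
- move=> x.
  have -> : V1 = fun y => c * (2 * n).+2%:R * y ^+ (2 * n).+1 + 2 * s * y
                          + H y * (2 * sin y) by [].
  have sin2 : chord2 x * (4 - chord2 x) = 4 * sin x ^+ 2.
    by rewrite sin2cos2 /chord2; ring.
  have cos2 : 2 - chord2 x = 2 * cos x by rewrite /chord2; ring.
  apply: is_derive_eq.
  by rewrite /GRing.scale /= /V2 sin2 cos2 natrM /H; ring.
- by rewrite /V /chord2 cos0 !exprS !mul0r !mulr0 !add0r mulr1 subrr.
- by rewrite /V1 sin0 !exprS !mul0r !mulr0 !addr0.
- move=> x /andP[x0 xt]; rewrite /V2.
  have xpi : 0 < x < pi by rewrite x0 (lt_trans xt).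
  have ux1 : 0 < chord2 x <= u1.
    by rewrite chord2_gt0 //= (le_trans _ tu1) // chord2_le ?(ltW x0) ?(ltW xt) ?(ltW tpi).
  apply: (lt_le_trans (pos _ ux1 (chord2_le4 x))).
  by rewrite !lerD2r ler_wpM2l ?mulr_ge0 ?ler0n ?Wt.
Qed.

End Comparison.

(** * Rational bounds for the scaled eigenvalue *)

Section Rational.
Context {R : realType}.
Implicit Types (t u e c s : R).

(* Polynomials in [u = chord2 t]: [h * mass_symbol] is the symbol of the mass
   matrix, [soft_symbol e / h] that of the stiffness matrix minus [e] times the
   softness matrix. The constants 5040, 1680 and the like are split into factors
   because numerals are unary. The suffixes 1 and 2 mark derivatives in [u]. *)
Definition mass_symbol u : R := 1 - u / 3 + u ^+ 2 / 40 - u ^+ 3 / 70 / 72.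
Definition mass_symbol1 u : R := - (1 / 3) + u / 20 - u ^+ 2 / 40 / 42.
Definition mass_symbol2 u : R := 1 / 20 - u / 840.

Definition soft_symbol e u : R := u - u ^+ 2 / 4 + u ^+ 3 / 120 - e * u ^+ 4.
Definition soft_symbol1 e u : R := 1 - u / 2 + u ^+ 2 / 40 - 4 * e * u ^+ 3.
Definition soft_symbol2 e u : R := - (1 / 2) + u / 20 - 12 * e * u ^+ 2.

Definition quotient e u : R := soft_symbol e u / mass_symbol u.

(** Numerator of the derivative of [quotient e]. In its own derivative [wronskian1] the products of
    two first derivatives cancel. *)
Definition wronskian e u : R :=
  soft_symbol1 e u * mass_symbol u - soft_symbol e u * mass_symbol1 u.
Definition wronskian1 e u : R :=
  soft_symbol2 e u * mass_symbol u - soft_symbol e u * mass_symbol2 u.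

(* [mass_symbol u ^ 3] times the second derivative in [t] of [quotient e (chord2 t)]. *)
Definition curvature e u : R :=
  (wronskian1 e u * mass_symbol u - 2 * wronskian e u * mass_symbol1 u)
    * (u * (4 - u))
  + wronskian e u * mass_symbol u * (2 - u).

(** The four Bernstein coefficients on [0, 4] are positive. *)
Lemma mass_symbol_gt0 u : 0 <= u <= 4 -> 0 < mass_symbol u.
Proof.
move=> /andP[u0 u4]; have w0 : 0 <= 4 - u by rewrite subr_ge0.
have h i j : 0 <= u ^+ i * (4 - u) ^+ j by rewrite mulr_ge0 ?exprn_ge0.
rewrite /mass_symbol.
by have := (h 0%N 3%N, h 1%N 2%N, h 2%N 1%N, h 3%N 0%N) => -[[[]]]; lra.
Qed.

Lemma is_derive_mass_symbol x : is_derive x (1 : R) mass_symbol (mass_symbol1 x).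
Proof.
have dm := is_derive_quintic mass_symbol 1 (- (1 / 3)) (1 / 40) (- (1 / 70 / 72)) 0 0 x.
apply: (is_derive_eq (dm _)) => [u|].
  by rewrite /mass_symbol; field.
by rewrite /mass_symbol1; field.
Qed.

Lemma is_derive_mass_symbol1 x : is_derive x (1 : R) mass_symbol1 (mass_symbol2 x).
Proof.
have dm := is_derive_quintic mass_symbol1 (- (1 / 3)) (1 / 20) (- (1 / 40 / 42)) 0 0 0 x.
apply: (is_derive_eq (dm _)) => [u|].
  by rewrite /mass_symbol1; field.
by rewrite /mass_symbol2; field.
Qed.

Lemma is_derive_soft_symbol e x :
  is_derive x (1 : R) (soft_symbol e) (soft_symbol1 e x).
Proof.
have dn := is_derive_quintic (soft_symbol e) 0 1 (- (1 / 4)) (1 / 120) (- e) 0 x.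
apply: (is_derive_eq (dn _)) => [u|].
  by rewrite /soft_symbol; field.
by rewrite /soft_symbol1; field.
Qed.

Lemma is_derive_soft_symbol1 e x :
  is_derive x (1 : R) (soft_symbol1 e) (soft_symbol2 e x).
Proof.
have dn := is_derive_quintic (soft_symbol1 e) 1 (- (1 / 2)) (1 / 40) (- (4 * e)) 0 0 x.
apply: (is_derive_eq (dn _)) => [u|].
  by rewrite /soft_symbol1; field.
by rewrite /soft_symbol2; field.
Qed.

Lemma is_derive_wronskian e x :
  is_derive x (1 : R) (wronskian e) (wronskian1 e x).
Proof.
have dw (f f1 g g1 f2 g2 : R -> R) : is_derive x (1 : R) f (f1 x) ->
    is_derive x (1 : R) f1 (f2 x) -> is_derive x (1 : R) g (g1 x) ->
    is_derive x (1 : R) g1 (g2 x) ->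
    is_derive x (1 : R) (fun u => f1 u * g u - f u * g1 u) (f2 x * g x - f x * g2 x).
  by move=> df df1 dg dg1; apply: is_derive_eq; rewrite /GRing.scale /=; ring.
exact: (dw _ _ _ _ _ _ (is_derive_soft_symbol e x) (is_derive_soft_symbol1 e x)
           (is_derive_mass_symbol x) (is_derive_mass_symbol1 x)).
Qed.

Lemma is_derive_div (f g : R -> R) (r f' g' x : R) :
  is_derive x (1 : R) f f' -> is_derive x (1 : R) g g' -> g x != 0 ->
  is_derive x (1 : R) (fun u => r * (f u / g u))
    (r * ((f' * g x - f x * g') / g x ^+ 2)).
Proof.
move=> df dg g0; have dV := is_deriveV g0 dg.
apply: is_derive_eq; rewrite /GRing.scale /=; by field.
Qed.

(** [chord2_comparison] for [r * quotient e], with the condition multiplied by [mass_symbol u ^ 3],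
    so that it is polynomial when [W] is. *)
Lemma quotient_comparison (W : R -> R) c s r e u1 t (n : nat) :
  (forall t, 0 < t < pi -> W (chord2 t) <= t ^+ (2 * n)) ->
  0 <= c ->
  (forall u, 0 < u <= u1 -> u <= 4 ->
     0 < (c * ((2 * n).+2 * (2 * n).+1)%:R * W u + 2 * s)
           * mass_symbol u ^+ 3 + r * curvature e u) ->
  0 < t < pi -> chord2 t <= u1 ->
  0 < c * t ^+ (2 * n).+2 + s * t ^+ 2 + r * quotient e (chord2 t).
Proof.
move=> Wt c0 pos tpi tu1.
pose F u := r * quotient e u.
pose F1 u := r * (wronskian e u / mass_symbol u ^+ 2).
pose F2 u := r * ((wronskian1 e u * mass_symbol u
                   - 2 * wronskian e u * mass_symbol1 u) / mass_symbol u ^+ 3).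
apply: (chord2_comparison F F1 F2 W c s u1 t n _ _ Wt c0 _ _ tpi tu1).
- move=> u u04; have m0 := lt0r_neq0 (mass_symbol_gt0 u u04).
  exact: is_derive_div (is_derive_soft_symbol e u) (is_derive_mass_symbol u) m0.
- move=> u u04; have m0 := lt0r_neq0 (mass_symbol_gt0 u u04).
  have dm2 := is_derive1_comp (is_derive_pow 2 (mass_symbol u)) (is_derive_mass_symbol u).
  have := is_derive_div _ _ r _ _ _ (is_derive_wronskian e u) dm2 (expf_neq0 2 m0).
  by move/is_derive_eq; apply; rewrite /F2 /=; field.
- by rewrite /F /quotient /soft_symbol !exprS !mul0r !mulr0 !oppr0 !addr0 mul0r mulr0.
- move=> u uu1 u4; have [u0 _] := andP uu1.
  have m0 : 0 < mass_symbol u by apply: mass_symbol_gt0; rewrite (ltW u0).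
  rewrite -(pmulr_lgt0 _ (exprn_gt0 3 m0)).
  have := pos u uu1 u4; congr (0 < _).
  rewrite /F1 /F2 /curvature; field; exact: lt0r_neq0.
Qed.

End Rational.

(* Adds [h i j], [h (i + 1) (j - 1)], and so on down to [h (i + j) 0]: the
   Bernstein basis of degree [i + j], after which positivity of a polynomial is
   a linear goal in its monomials. *)
Ltac bernstein h i j :=
  match j with
  | O => have := h i j
  | S ?j' => have := h i j; bernstein h (S i) j'
  end.

(** * Polynomial certificates for the one-sided bounds *)

Section Inequalities.
Context {R : realType}.
Implicit Types (t u e c s : R).

(* Partial sum of the expansion of [t ^ 2 = 4 arcsin(sqrt u / 2) ^ 2] in [u]. *)
Definition arcsine_trunc u : R :=
  u + u ^+ 2 / 12 + u ^+ 3 / 90 + u ^+ 4 / 560 + u ^+ 5 / 45 / 70.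

Definition arcsine_trunc1 u : R :=
  1 + u / 6 + u ^+ 2 / 30 + u ^+ 3 / 140 + u ^+ 4 / 630.

Definition arcsine_trunc2 u : R :=
  1 / 6 + u / 15 + 3 * u ^+ 2 / 140 + 4 * u ^+ 3 / 630.

Lemma arcsine_trunc_ge0 u : 0 <= u -> 0 <= arcsine_trunc u.
Proof.
move=> u0; rewrite /arcsine_trunc.
have h i : 0 <= u ^+ i by rewrite exprn_ge0.
by have := (h 2%N, h 3%N, h 4%N, h 5%N) => -[[[]]]; lra.
Qed.

Lemma is_derive_arcsine_trunc x :
  is_derive x (1 : R) (fun u => - arcsine_trunc u) (- arcsine_trunc1 x).
Proof.
have da := is_derive_quintic (fun u => - arcsine_trunc u) 0 (- 1) (- (1 / 12))
  (- (1 / 90)) (- (1 / 560)) (- (1 / 45 / 70)) x.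
apply: (is_derive_eq (da _)) => [u|].
  by rewrite /arcsine_trunc; field.
by rewrite /arcsine_trunc1; field.
Qed.

Lemma is_derive_arcsine_trunc1 x :
  is_derive x (1 : R) (fun u => - arcsine_trunc1 u) (- arcsine_trunc2 x).
Proof.
have da := is_derive_quintic (fun u => - arcsine_trunc1 u) (- 1) (- (1 / 6))
  (- (1 / 30)) (- (1 / 140)) (- (1 / 630)) 0 x.
apply: (is_derive_eq (da _)) => [u|].
  by rewrite /arcsine_trunc1; field.
by rewrite /arcsine_trunc2; field.
Qed.

(** The full series solves F''(u) u (4 - u) + F'(u) (2 - u) = 2. Truncation leaves only the positive
    residual u^5 / 126, so the comparison applies with c = 0 and s = 1. *)
Lemma arcsine_trunc_le t : 0 < t < pi -> arcsine_trunc (chord2 t) <= t ^+ 2.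
Proof.
move=> t0pi; rewrite -subr_ge0; apply: ltW.
have cmp := chord2_comparison _ _ _ (fun=> 1) 0 1 4 t 0
  (fun u _ => is_derive_arcsine_trunc u) (fun u _ => is_derive_arcsine_trunc1 u)
  (fun _ _ => lexx 1) (lexx 0) _ _ t0pi (chord2_le4 t).
rewrite -[_ - _]add0r addrA -[X in X + _ + _](mul0r (t ^+ 2)) -[X in _ + X + _]mul1r.
apply: cmp => [|u /andP[u0 _] u4].
  by rewrite /arcsine_trunc !exprS !mul0r !addr0 oppr0.
rewrite /arcsine_trunc1 /arcsine_trunc2.
have := exprn_gt0 5 u0; have := exprn_gt0 4 u0; lra.
Qed.

(* Truncated expansions of [t ^ 6] and [t ^ 8] in [u], with coefficients rounded
   down; the truncation keeps the Bernstein degrees below small. *)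
Definition arcsine_trunc_pow3 u : R :=
  u ^+ 3 * (1 + u / 4 + 13 / 240 * u ^+ 2 + u ^+ 3 / 88 + u ^+ 4 / 420
            + u ^+ 5 / 3000 + u ^+ 6 / 70 / 300).

Definition arcsine_trunc_pow4 u : R :=
  u ^+ 4 * (1 + u / 3 + 31 / 360 * u ^+ 2 + u ^+ 3 / 49 + u ^+ 4 / 210
            + u ^+ 5 / 1200 + u ^+ 6 / 80 / 90 + u ^+ 7 / 150 / 300).

(** The coefficients agree with those of [arcsine_trunc u ^ 3] through u^5 and do not exceed them
    from u^6 on. *)
Lemma arcsine_trunc_pow3_le t :
  0 < t < pi -> arcsine_trunc_pow3 (chord2 t) <= t ^+ (2 * 3).
Proof.
move=> t0pi; have := arcsine_trunc_le t t0pi; set u := chord2 t => ut.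
have u0 : 0 <= u := chord2_ge0 t.
have h i : 0 <= u ^+ i by rewrite exprn_ge0.
have P0 := arcsine_trunc_ge0 _ u0.
rewrite exprM; apply: (le_trans _ (lerXn2r 3 _ _ ut)); rewrite ?nnegrE ?sqr_ge0 //.
rewrite /arcsine_trunc_pow3 /arcsine_trunc.
have := (h 6%N, h 7%N, h 8%N, h 9%N, h 10%N, h 11%N, h 12%N, h 13%N, h 14%N,
         h 15%N) => -[[[[[[[[[]]]]]]]]].
lra.
Qed.

Lemma arcsine_trunc_pow4_le t :
  0 < t < pi -> arcsine_trunc_pow4 (chord2 t) <= t ^+ (2 * 4).
Proof.
move=> t0pi; have := arcsine_trunc_le t t0pi; set u := chord2 t => ut.
have u0 : 0 <= u := chord2_ge0 t.
have h i : 0 <= u ^+ i by rewrite exprn_ge0.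
have P0 := arcsine_trunc_ge0 _ u0.
rewrite exprM; apply: (le_trans _ (lerXn2r 4 _ _ ut)); rewrite ?nnegrE ?sqr_ge0 //.
rewrite /arcsine_trunc_pow4 /arcsine_trunc.
have := (h 6%N, h 7%N, h 8%N, h 9%N, h 10%N, h 11%N, h 12%N, h 13%N, h 14%N,
         h 15%N, h 16%N, h 17%N, h 18%N, h 19%N, h 20%N)
  => -[[[[[[[[[[[[[[]]]]]]]]]]]]]].
lra.
Qed.

(** [e0] is 1/30240, the value of [e] at which the u^4 term in the expansion of [quotient e u] minus
    t^2 vanishes; [c0] is 131/332640. *)
Let e0 : R := 1 / 240 / 126.
Let c0 : R := 131 / 660 / 504.

(** The end point e = 0 serves every parameter here, because [quotient e u] decreases in [e]. *)
Lemma quotient_upper t : 0 < t < pi ->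
  quotient 0 (chord2 t) < t ^+ 2 + c0 * t ^+ 8.
Proof.
move=> t0pi; rewrite -subr_gt0.
have := @quotient_comparison _ arcsine_trunc_pow3 c0 1 (- 1) 0 4 t 3
  arcsine_trunc_pow3_le _ _ t0pi (chord2_le4 t).
rewrite mul1r mulN1r [c0 * _ + _]addrC; apply.
  by rewrite /c0; lra.
move=> u /andP[u0 _] u4; rewrite /c0 /curvature /wronskian /wronskian1.
rewrite /soft_symbol /soft_symbol1 /soft_symbol2.
rewrite /mass_symbol /mass_symbol1 /mass_symbol2 /arcsine_trunc_pow3.
(* The polynomial has degree 18 and a factor u^3, which leaves Bernstein degree 15; the top monomial
   makes the inequality strict. *)
have h0 : 0 < u ^+ 18 by rewrite exprn_gt0.
have h i j : 0 <= u ^+ (3 + i) * (4 - u) ^+ j.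
  by rewrite mulr_ge0 ?exprn_ge0 // ?subr_ge0 // ltW.
bernstein h 0%N 15%N; rewrite ![(3 + _)%N]/=.
lra.
Qed.

Lemma quotient_lower t : 0 < t < pi ->
  t ^+ 2 < quotient (1 / 480) (chord2 t) + (c0 + 1 / 480) * t ^+ 8.
Proof.
move=> t0pi; rewrite -subr_gt0 [quotient _ _ + _]addrC addrAC.
have := @quotient_comparison _ arcsine_trunc_pow3 (c0 + 1 / 480) (- 1) 1 (1 / 480) 4 t 3
  arcsine_trunc_pow3_le _ _ t0pi (chord2_le4 t).
rewrite (mul1r (quotient _ _)) mulN1r; apply.
  by rewrite /c0; lra.
move=> u /andP[u0 _] u4; rewrite /c0 /curvature /wronskian /wronskian1.
rewrite /soft_symbol /soft_symbol1 /soft_symbol2.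
rewrite /mass_symbol /mass_symbol1 /mass_symbol2 /arcsine_trunc_pow3.
have h0 : 0 < u ^+ 18 by rewrite exprn_gt0.
have h i j : 0 <= u ^+ (3 + i) * (4 - u) ^+ j.
  by rewrite mulr_ge0 ?exprn_ge0 // ?subr_ge0 // ltW.
bernstein h 0%N 15%N; rewrite ![(3 + _)%N]/=.
lra.
Qed.

(** At [e0] the error starts only at t^10, hence the comparison with [arcsine_trunc_pow4] and a
    factor u^4. *)
Lemma quotient_upper_optimal t : 0 < t < pi ->
  quotient e0 (chord2 t) < t ^+ 2 + 1 / 280 / 99 * t ^+ 10.
Proof.
move=> t0pi; rewrite -subr_gt0.
have := @quotient_comparison _ arcsine_trunc_pow4 (1 / 280 / 99) 1 (- 1) e0 4 t 4
  arcsine_trunc_pow4_le _ _ t0pi (chord2_le4 t).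
rewrite (mul1r (t ^+ 2)) mulN1r [_ * _ + t ^+ 2]addrC; apply.
  by lra.
move=> u /andP[u0 _] u4; rewrite /e0 /curvature /wronskian /wronskian1.
rewrite /soft_symbol /soft_symbol1 /soft_symbol2.
rewrite /mass_symbol /mass_symbol1 /mass_symbol2 /arcsine_trunc_pow4.
have h0 : 0 < u ^+ 20 by rewrite exprn_gt0.
have h i j : 0 <= u ^+ (4 + i) * (4 - u) ^+ j.
  by rewrite mulr_ge0 ?exprn_ge0 // ?subr_ge0 // ltW.
bernstein h 0%N 16%N; rewrite ![(4 + _)%N]/=.
lra.
Qed.

(* Up to the cut-off 37/10 convexity alone suffices; it fails closer to [u = 4],
   but there [quotient_ge7] leaves ample room. *)
Lemma quotient_lower_optimal t : 0 < t < pi -> chord2 t <= 37 / 10 ->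
  t ^+ 2 < quotient e0 (chord2 t).
Proof.
move=> t0pi tu; rewrite -subr_gt0.
have := @quotient_comparison _ (fun=> 1) 0 (- 1) 1 e0 (37 / 10) t 0
  (fun _ _ => lexx 1) (lexx 0) _ t0pi tu.
rewrite (mul0r (t ^+ _)) add0r (mul1r (quotient _ _)) mulN1r [- _ + _]addrC; apply.
move=> u /andP[u0 u1] u4; rewrite /e0 /curvature /wronskian /wronskian1.
rewrite /soft_symbol /soft_symbol1 /soft_symbol2.
rewrite /mass_symbol /mass_symbol1 /mass_symbol2.
have h0 : 0 < u ^+ 10 by rewrite exprn_gt0.
have h i j : 0 <= u ^+ (4 + i) * (37 / 10 - u) ^+ j.
  by rewrite mulr_ge0 ?exprn_ge0 // ?subr_ge0 // ltW.
bernstein h 0%N 6%N; rewrite ![(4 + _)%N]/=.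
lra.
Qed.

(** The threshold 7 is matched by [quartic_tangent] and [quintic_tangent], which settle the range
    near u = 4. *)
Lemma quotient_ge7 u : 37 / 10 <= u <= 4 -> 7 <= quotient e0 u.
Proof.
move=> /andP[u1 u4]; have u0 : 0 <= u by lra.
rewrite /quotient ler_pdivlMr; last by rewrite mass_symbol_gt0 // u0.
rewrite /soft_symbol /mass_symbol /e0.
have h i j : 0 <= (u - 37 / 10) ^+ i * (4 - u) ^+ j.
  by rewrite mulr_ge0 ?exprn_ge0 // subr_ge0.
bernstein h 0%N 4%N.
lra.
Qed.

End Inequalities.

(** * Sine modes as eigenvectors *)

Section Stencil.
Context {R : realType}.
Implicit Types (t x : R) (a : seq R).

Lemma sin_periodz (m : int) x : sin (x + m%:~R * (2 * pi)) = sin x.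
Proof.
have per (n : nat) (y : R) : sin (y + n%:R * (2 * pi)) = sin y.
  by rewrite !mulr_natl (periodicn (@sinD2pi R)).
case: (intP m) => [|n|n]; first by rewrite mul0r addr0.
  by rewrite -pmulrn per.
by rewrite -[LHS](per n.+1) mulrNz -pmulrn mulNr subrK.
Qed.

(** Used twice: to pair the residues l and -l mod 2N, and to pair the stencil offsets r and -r. *)
Lemma sum_centered {V : zmodType} (H : nat -> V) n :
  \sum_(0 <= q < n.*2.+1) H q
  = H n + \sum_(0 <= r < n) (H (n + r.+1)%N + H (n - r.+1)%N).
Proof.
rewrite (big_cat_nat (n := n)) //=; last by lia.
rewrite [X in _ + X]big_ltn; last by lia.
rewrite big_split /= big_nat_rev /= addrCA; congr (_ + _); rewrite addrC.
congr (_ + _); rewrite -{1}[n.+1]add0n big_addn.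
have -> : (n.*2.+1 - n.+1)%N = n by lia.
by apply: eq_bigr => r _; rewrite addnC addSnnS.
Qed.

Lemma sum_blocks {V : nmodType} (H : nat -> V) q n :
  \sum_(0 <= i < n) \sum_(0 <= r < q) H (r + q * i)%N = \sum_(0 <= p < q * n) H p.
Proof.
elim: n => [|n IH]; first by rewrite muln0 !big_geq.
rewrite big_nat_recr //= IH mulnS (addnC q).
rewrite [RHS](big_cat_nat (n := (q * n)%N)) ?leq_addr //=.
congr (_ + _); rewrite -{2}[(q * n)%N]add0n big_addn.
by have -> : (q * n + q - q * n)%N = q by lia.
Qed.

Lemma sum_window {V : nmodType} (H : nat -> V) s w n :
  (s + w <= n)%N -> (forall p, ~~ (s <= p < s + w)%N -> H p = 0) ->
  \sum_(0 <= p < n) H p = \sum_(0 <= q < w) H (q + s)%N.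
Proof.
move=> swn H0; rewrite (big_cat_nat (n := s)) //=; last by lia.
rewrite (big_cat_nat (n := (s + w)%N) (m := s)) //=; last by lia.
rewrite big_nat_cond big1 ?add0r => [|p]; last by move=> hp; apply: H0; lia.
rewrite [X in _ + X]big_nat_cond [X in _ + X]big1 ?addr0 => [|p]; last first.
  by move=> hp; apply: H0; lia.
rewrite -{1}[s]add0n big_addn.
by have -> : (s + w - s)%N = w by lia.
Qed.

Lemma fsum_int (f : int -> R) (L : nat) : (forall m, (L < `|m|)%N -> f m = 0) ->
  \sum_(m \in [set: int]) f m = \sum_(0 <= i < L.*2.+1) f (Posz i - Posz L).
Proof.
move=> f0.
pose r : seq int := [seq (Posz i - Posz L)%R | i <- index_iota 0 L.*2.+1].
rewrite -(big_map (fun i : nat => (Posz i - Posz L)%R) xpredT f) -/r [RHS]bigfs //.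
- by apply: eq_fsbigl; apply/seteqP; split.
- by rewrite map_inj_uniq ?iota_uniq // => x y; lia.
- move=> m _ mr; apply: f0; rewrite ltnNge; apply: contra mr => mL.
  apply/mapP; exists (absz (m + Posz L)); last by lia.
  by rewrite mem_index_iota; lia.
Qed.

(** The last term reads past the end of [a] and is 0; this range matches the window of width 2
    [size a] + 1 below. *)
Definition stencil_symbol a t : R :=
  nth 0 a 0 + \sum_(0 <= r < size a) nth 0 a r.+1 * (2 * cos (r.+1%:R * t)).

(** By oddness and periodicity of the sine, the sum over l and m becomes a sum over all integers n
    of -a_|k+n| sin(nt): the missing multiples of N contribute 0. Recentring at n = -k and pairing
    opposite offsets gives the symbol. *)
Lemma stencil_mx_sine_mode N j a : (0 < N)%N ->
  stencil_mx N a *m sine_mode R N j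
  = stencil_symbol a (j%:R * pi * mesh_size R N) *: sine_mode R N j.
Proof.
move=> N0; set t := j%:R * pi * mesh_size R N.
have Nt : N%:R * t = j%:R * pi.
  by rewrite /t /mesh_size mulrCA mulfV ?mulr1 // pnatr_eq0 -lt0n.
apply/matrixP => i z; rewrite !mxE; set k : int := Posz i.+1.
have kN : (i.+1 < N)%N by case: i {k} => i /= ; lia.
set L := size a.
have a0 n : (L <= n)%N -> nth 0 a n = 0 by move=> ?; rewrite nth_default.
pose g (n : int) : R := - (nth 0 a (absz (k + n)) * sin (n%:~R * t)).
have sinjpi : sin (j%:R * pi) = 0 :> R.
  elim: (j) => [|n IH]; first by rewrite mul0r sin0.
  by rewrite -natr1 mulrDl mul1r sinDpi IH oppr0.
have sin_shift (n m : int) : sin ((n + Posz (2 * N) * m)%:~R * t) = sin (n%:~R * t).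
  rewrite rmorphD rmorphM /= mulrDl.
  have -> : (Posz (2 * N))%:~R * m%:~R * t = (m * Posz j)%:~R * (2 * pi) :> R.
    rewrite rmorphM /= -!pmulrn natrM mulrAC -[2 * N%:R * t]mulrA Nt.
    by ring.
  exact: sin_periodz.
(* Residues are centred at N, so that r = N + l and r = N - l stand for l and -l modulo 2N. *)
pose block (m r : nat) : int := Posz r - Posz N + Posz (2 * N) * (Posz m - Posz L).
have entry (l : 'I_N.-1) : stencil_mx N a i l * sine_mode R N j l z
    = \sum_(0 <= m < L.*2.+1) (g (block m (N + l.+1)%N) + g (block m (N - l.+1)%N)).
  have lN : (l.+1 < N)%N by case: l => l /= ; lia.
  rewrite !mxE -/t /= (@fsum_int _ L) => [|m Lm]; last by rewrite !a0 ?subrr //; nia.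
  rewrite big_distrl /=; apply: eq_bigr => m _.
  have -> : block m (N + l.+1)%N = Posz l.+1 + Posz (2 * N) * (Posz m - Posz L).
    by rewrite /block; lia.
  have -> : block m (N - l.+1)%N = - Posz l.+1 + Posz (2 * N) * (Posz m - Posz L).
    by rewrite /block; lia.
  rewrite /g !sin_shift mulrNz mulNr sinN -pmulrn !addrA -/k.
  by ring.
under eq_bigr do rewrite entry.
rewrite -(big_mkord xpredT (fun l => \sum_(0 <= m < L.*2.+1)
  (g (block m (N + l.+1)%N) + g (block m (N - l.+1)%N)))) exchange_big_nat /=.
pose h (p : nat) := g (Posz p - Posz (N + 2 * N * L)).
transitivity (\sum_(0 <= m < L.*2.+1) \sum_(0 <= r < 2 * N) h (r + 2 * N * m)%N).
  apply: eq_bigr => m _.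
  have hb r : h (r + 2 * N * m)%N = g (block m r).
    by rewrite /h /block; congr g; lia.
  under [RHS]eq_bigr do rewrite hb.
  have -> : (2 * N = (N.-1.*2.+1).+1)%N by lia.
  rewrite [RHS]big_nat_recl // sum_centered.
  (* The two unpaired residues, r = 0 and r = N, are multiples of N, where sin(nt) vanishes. *)
  have -> : g (block m 0) = 0.
    rewrite /g /block sin_shift sub0r mulrNz -pmulrn mulNr Nt sinN sinjpi.
    by rewrite oppr0 mulr0 oppr0.
  have -> : g (block m N.-1.+1) = 0.
    by rewrite /g /block sin_shift prednK // subrr mul0r sin0 mulr0 oppr0.
  rewrite !add0r; apply: eq_big_nat => r rN.
  by congr (g (block m _) + g (block m _)); lia.
(* The stencil is supported on |k + n| < L, inside the window of width 2L + 1 centred at n = -k. *)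
rewrite sum_blocks (@sum_window _ h (N + 2 * N * L - L - i.+1) L.*2.+1); first last.
- move=> p hp; rewrite /h /g a0 ?mul0r ?oppr0 // /k.
  nia.
- nia.
rewrite sum_centered.
have hE (q : nat) : h (q + (N + 2 * N * L - L - i.+1))%N
    = - (nth 0 a (absz (Posz q - Posz L)) * sin ((Posz q - Posz L)%:~R * t - i.+1%:R * t)).
  have qE : Posz (q + (N + 2 * N * L - L - i.+1)) - Posz (N + 2 * N * L)
      = Posz q - Posz L - k by rewrite /k; nia.
  by rewrite /h /g qE [k + _]addrC subrK [(_ - k)%:~R]rmorphB /= mulrBl -pmulrn.
rewrite !hE subrr mul0r add0r absz0 sinN mulrN opprK /stencil_symbol mulrDl.
congr (_ + _); rewrite big_distrl /=; apply: eq_big_nat => r rL.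
rewrite !hE.
have -> : Posz (L + r.+1) - Posz L = Posz r.+1 by lia.
have -> : Posz (L - r.+1) - Posz L = - Posz r.+1 by lia.
rewrite abszN /= mulrNz -pmulrn mulNr.
by rewrite sinB -(opprD (r.+1%:R * t)) sinN sinD; ring.
Qed.

End Stencil.

(** * Error estimates *)

Section Error.
Context {R : realType}.
Implicit Types (t x u e eta : R).

Lemma quotientE e u : quotient e u = quotient 0 u - e * (u ^+ 4 / mass_symbol u) :> R.
Proof. by rewrite /quotient /soft_symbol mul0r subr0 mulrBl mulrA. Qed.

(* The sharp constants in the next two lemmas are about 6.45 and 6.91. *)
Lemma quartic_tangent (x : R) : x - 131 / 660 / 504 * x ^+ 4 < 7.
Proof.
(* Tangent line at a = 43/5, close to the maximiser: x^4 - 4 a^3 x + 3 a^4 = (x^2 - a^2)^2 + 2 a^2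
   (x - a)^2. *)
have := sqr_ge0 x; have := sqr_ge0 (x ^+ 2 - 1849 / 25).
have := sqr_ge0 (x - 43 / 5); lra.
Qed.

Lemma quintic_tangent (x : R) : 0 <= x -> x - 1 / 280 / 99 * x ^+ 5 < 7.
Proof.
(* Again 863/100 is close to the maximiser; the quintic minus its tangent line is (x - a)^2 times a
   cubic with positive coefficients. *)
move=> x0; have h i : 0 <= x ^+ i * (x - 863 / 100) ^+ 2.
  exact: mulr_ge0 (exprn_ge0 _ x0) (sqr_ge0 _).
by have := (h 0%N, h 1%N, h 2%N, h 3%N) => -[[[]]]; lra.
Qed.

Lemma quotient_error t eta : 0 < t < pi -> 0 <= eta < 1 / 480 ->
  `|quotient eta (chord2 t) - t ^+ 2| < (131 / 660 / 504 + eta) * t ^+ 8.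
Proof.
move=> t0pi /andP[eta0 eta1]; set u := chord2 t.
have u0 : 0 < u := chord2_gt0 t t0pi; have u4 : u <= 4 := chord2_le4 t.
have m0 : 0 < mass_symbol u by rewrite mass_symbol_gt0 // ltW.
have h0 : 0 < u ^+ 4 / mass_symbol u by rewrite divr_gt0 ?exprn_gt0.
have up := quotient_upper t t0pi; have low := quotient_lower t t0pi.
have t8 : 0 < t ^+ 8 by case/andP: t0pi => ? _; rewrite exprn_gt0.
(* The lower bound at eta = 0 follows from the one at 1/30240, since lowering the parameter raises
   the quotient. *)
have low0 : t ^+ 2 < quotient 0 u + 131 / 660 / 504 * t ^+ 8.
  have [u1|u1] := leP u (37 / 10).
    have := quotient_lower_optimal t t0pi u1; rewrite -/u quotientE; lra.
  have := quotient_ge7 u; rewrite (ltW u1) u4 quotientE => /(_ isT).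
  have := quartic_tangent (t ^+ 2); rewrite -exprM; lra.
move: up low; rewrite -/u (quotientE (1 / 480)) (quotientE eta).
move: low0 h0; set q := quotient 0 u; set H := u ^+ 4 / mass_symbol u => low0 h0 up low.
have etaH : 0 <= eta * H by rewrite mulr_ge0 // ltW.
have etat : 0 <= eta * t ^+ 8 by rewrite mulr_ge0 // ltW.
rewrite ltr_norml; apply/andP; split; last by lra.
(* [p1] + 480 [p2] is the convex combination of the bounds at 0 and 1/480 with weights 1 - 480 eta
   and 480 eta. *)
have p1 : 0 < (1 - 480 * eta) * (q + 131 / 660 / 504 * t ^+ 8 - t ^+ 2).
  by apply: mulr_gt0; lra.
have p2 : 0 <= eta * (q - 1 / 480 * H + (131 / 660 / 504 + 1 / 480) * t ^+ 8 - t ^+ 2).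
  by apply: mulr_ge0; lra.
by lra.
Qed.

Lemma quotient_error_optimal t : 0 < t < pi ->
  `|quotient (1 / 240 / 126) (chord2 t) - t ^+ 2| < 1 / 280 / 99 * t ^+ 10.
Proof.
move=> t0pi; set u := chord2 t.
have u4 : u <= 4 := chord2_le4 t.
have t10 : 0 < t ^+ 10 by case/andP: t0pi => ? _; rewrite exprn_gt0.
have up := quotient_upper_optimal t t0pi.
rewrite ltr_norml; apply/andP; split; last by lra.
have [u1|u1] := leP u (37 / 10).
  have := quotient_lower_optimal t t0pi u1; rewrite -/u; lra.
have := quotient_ge7 u; rewrite (ltW u1) u4 => /(_ isT).
have := quintic_tangent (t ^+ 2) (sqr_ge0 t); rewrite -exprM; lra.
Qed.

Lemma cosM2 t : cos (2 * t) = 2 * cos t ^+ 2 - 1.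
Proof.
have -> : 2 * t = t + t by ring.
by rewrite cosD -!expr2 sin2cos2; ring.
Qed.

Lemma cosM3 t : cos (3 * t) = 4 * cos t ^+ 3 - 3 * cos t.
Proof.
have -> : 3 * t = 2 * t + t by ring.
rewrite cosD cosM2.
have -> : sin (2 * t) = 2 * sin t * cos t.
  have -> : 2 * t = t + t by ring.
  by rewrite sinD; ring.
have -> : 2 * sin t * cos t * sin t = 2 * cos t * sin t ^+ 2 by ring.
by rewrite sin2cos2; ring.
Qed.

Lemma cosM4 t : cos (4 * t) = 8 * cos t ^+ 4 - 8 * cos t ^+ 2 + 1.
Proof.
have -> : 4 * t = 2 * (2 * t) by ring.
by rewrite !cosM2; ring.
Qed.

End Error.

(** * Symbols of the three matrices and the paired eigenvalue *)

Section Eigenvalue.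
Context {R : realType} (N : nat) (N0 : (0 < N)%N).
Let h := mesh_size R N.

Lemma stiffness_mx_sine_mode j :
  stiffness_mx R N *m sine_mode R N j
  = (h^-1 * soft_symbol 0 (chord2 (j%:R * pi * h))) *: sine_mode R N j.
Proof.
rewrite stencil_mx_sine_mode // -/h; congr (_ *: _).
rewrite /stencil_symbol /= !big_nat_recl // big_geq //= cosM2 cosM3.
rewrite /soft_symbol /chord2 (mul1r (_ * h)).
move: (cos _) h^-1 => c v; by field.
Qed.

Lemma softness_mx_sine_mode j :
  softness_mx R N *m sine_mode R N j
  = (h^-1 * chord2 (j%:R * pi * h) ^+ 4) *: sine_mode R N j.
Proof.
rewrite stencil_mx_sine_mode // -/h; congr (_ *: _).
rewrite /stencil_symbol /= !big_nat_recl // big_geq //= cosM2 cosM3 cosM4.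
rewrite /chord2 (mul1r (_ * h)).
move: (cos _) h^-1 => c v; by ring.
Qed.

Lemma mass_mx_sine_mode j :
  mass_mx R N *m sine_mode R N j
  = (h * mass_symbol (chord2 (j%:R * pi * h))) *: sine_mode R N j.
Proof.
rewrite stencil_mx_sine_mode // -/h; congr (_ *: _).
rewrite /stencil_symbol /= !big_nat_recl // big_geq //= cosM2 cosM3.
rewrite /mass_symbol /chord2 (mul1r (_ * h)).
move: (cos _); move: h => v c; by field.
Qed.

Lemma mode_angle_itv (j : nat) : (1 <= j <= N - 1)%N -> 0 < j%:R * pi * h < pi.
Proof.
move=> jN; rewrite /h /mesh_size !mulr_gt0 ?pi_gt0 ?invr_gt0 ?ltr0n //=; last by lia.
by rewrite ltr_pdivrMr ?ltr0n // mulrC ltr_pM2l ?pi_gt0 // ltr_nat; lia.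
Qed.

(** The sine vector is nonzero, its first entry being sin t > 0, and the mass symbol is positive, so
    the eigenvalue equation has exactly one solution [mu]. *)
Lemma approx_eigenvalueP eta (j : nat) (mu : R) : (1 <= j <= N - 1)%N ->
  approx_eigenvalue N eta j mu
  <-> mu = quotient eta (chord2 (j%:R * pi * h)) / h ^+ 2.
Proof.
move=> jN; set t := j%:R * pi * h; set u := chord2 t.
have hgt0 : 0 < h by rewrite invr_gt0 ltr0n.
have t0pi : 0 < t < pi := mode_angle_itv _ jN.
have m0 : 0 < mass_symbol u.
  by rewrite mass_symbol_gt0 // chord2_ge0 chord2_le4.
have U0 : sine_mode R N j != 0.
  have N1 : (0 < N.-1)%N by lia.
  apply/negP => /eqP /matrixP /(_ (Ordinal N1) 0); rewrite !mxE mul1r -/h -/t.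
  by apply/eqP; rewrite lt0r_neq0 // sin_gt0_pi.
rewrite /approx_eigenvalue /softIGA_eigenpair mulmxBl -scalemxAl.
rewrite stiffness_mx_sine_mode softness_mx_sine_mode mass_mx_sine_mode.
rewrite -/t -/u !scalerA -scalerBl.
have -> : h^-1 * soft_symbol 0 u - eta * (h^-1 * u ^+ 4) = h^-1 * soft_symbol eta u.
  by rewrite /soft_symbol; ring.
have h0 := lt0r_neq0 hgt0; have m0' := lt0r_neq0 m0.
split=> [[_ /eqP]|->].
  rewrite -subr_eq0 -scalerBl scaler_eq0 (negPf U0) orbF subr_eq0 => /eqP E.
  rewrite /quotient; apply: (mulIf (mulf_neq0 h0 m0')); rewrite -E.
  by field; rewrite h0 m0'.
split=> //; congr (_ *: _); rewrite /quotient.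
by field; rewrite h0 m0'.
Qed.

End Eigenvalue.

(** The factor h^-2 cancels in the quotient, and dividing by t^2 lowers the exponent by two. *)
Lemma relative_error (R : realType) (h t q lam c : R) (n : nat) :
  0 < h -> 0 < t -> lam = t ^+ 2 / h ^+ 2 ->
  `|q - t ^+ 2| < c * t ^+ n.+2 ->
  `|q / h ^+ 2 - lam| / lam < c * t ^+ n.
Proof.
move=> h0 t0 ->; have h2 : 0 < h ^- 2 by rewrite invr_gt0 exprn_gt0.
have t2 : 0 < t ^+ 2 by rewrite exprn_gt0.
rewrite -mulrBl normrM (gtr0_norm h2) -mulf_div divff ?lt0r_neq0 // mulr1.
by rewrite ltr_pdivrMr // -mulrA -exprD addn2.
Qed.

Theorem theorem3 (R : realType) (N : nat) (eta : R)
    (hN : (2 <= N)%N) (eta_ge0 : 0 <= eta) (eta_lt : eta < 1 / 480) :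
  exists lamh : nat -> R,
    [/\ (forall j : nat, (1 <= j <= N - 1)%N ->
           forall mu : R, approx_eigenvalue N eta j mu <-> mu = lamh j),
        (forall j : nat, (1 <= j <= N - 1)%N ->
           `|lamh j - dirichlet_eigenvalue R j| / dirichlet_eigenvalue R j
           < (131 / (332 * 1000 + 640) + eta)
             * (j%:R * pi * mesh_size R N) ^+ 6)
      & (eta = 1 / (30 * 1000 + 240) ->
         forall j : nat, (1 <= j <= N - 1)%N ->
           `|lamh j - dirichlet_eigenvalue R j| / dirichlet_eigenvalue R j
           < 1 / (27 * 1000 + 720)
             * (j%:R * pi * mesh_size R N) ^+ 8)].
Proof.
have N0 : (0 < N)%N by lia.
have h0 : 0 < mesh_size R N by rewrite invr_gt0 ltr0n.
pose t j : R := j%:R * pi * mesh_size R N.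
have t0pi j : (1 <= j <= N - 1)%N -> 0 < t j < pi by exact: mode_angle_itv.
have lamE j : dirichlet_eigenvalue R j = t j ^+ 2 / mesh_size R N ^+ 2.
  rewrite /dirichlet_eigenvalue /t; field; exact: lt0r_neq0.
exists (fun j => quotient eta (chord2 (t j)) / mesh_size R N ^+ 2); split.
- by move=> j jN mu; exact: approx_eigenvalueP.
- move=> j jN; have /andP[tgt0 _] := t0pi j jN.
  apply: relative_error => //.
  have -> : 332 * 1000 + 640 = 660 * 504 :> R by ring.
  rewrite invfM [131 * _]mulrA; apply: quotient_error; rewrite ?t0pi //.
  by rewrite eta_ge0.
- move=> etaE j jN; have /andP[tgt0 _] := t0pi j jN.
  apply: relative_error => //.
  have -> : 27 * 1000 + 720 = 280 * 99 :> R by ring.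
  rewrite etaE; have -> : 30 * 1000 + 240 = 240 * 126 :> R by ring.
  rewrite !invfM ![1 * (_ / _)]mulrA; apply: quotient_error_optimal; exact: t0pi.
Qed.
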